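(* Let $p$ be an odd prime, $r\ge 1$ and $s\ge 0$ integers; if $p=3$ assume $r\ge\min\{2,s\}$. For $k\ge 1$ let $$S_k=\{c_0+c_1p+\cdots+c_{\min(r,k)-1}p^{\min(r,k)-1} : 0\le c_i\le p-1,\ 1\le c_0\le \tfrac12(p-1)\}.$$ Put $\alpha_s=\zeta_{p^r}+\sum_{k=1}^{s}\sum_{t\in S_k}\zeta_{p^{r+k}}^{t}$ (so $\alpha_0=\zeta_{p^r}$). Then $\mathbb{Z}[\zeta_{p^{r+s}}]=\mathcal{A}_{\mathbb{Q}(\zeta_{p^{r+s}})/\mathbb{Q}(\zeta_{p^r})^+}\cdot\alpha_s$. In particular $\mathbb{Q}(\zeta_{p^{r+s}})/\mathbb{Q}(\zeta_{p^r})^+$ is Leopoldt.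
   Context: Roots of unity are chosen compatibly: for each $k$ a primitive $k$-th root of unity $\zeta_k\in\mathbb{C}$ is fixed such that $\zeta_l^{l/k}=\zeta_k$ whenever $k\mid l$. $\mathbb{Q}(\zeta_n)^+$ is the maximal real subfield of $\mathbb{Q}(\zeta_n)$. For a finite Galois extension of number fields $L/K$ with group $G$, the associated order is $\mathcal{A}_{L/K}=\{x\in K[G] : x(\mathcal{O}_L)\subseteq\mathcal{O}_L\}$. An extension $L/K$ with $L/\mathbb{Q}$ abelian is Leopoldt if $\mathcal{O}_L$ is free over $\mathcal{A}_{L/K}$. *)

(* Defs.v *)
From HB Require Import structures.
From mathcomp Require Import all_boot all_order all_fingroup all_algebra.
From mathcomp Require Import all_solvable all_field.

Set Implicit Arguments.
Unset Strict Implicit.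
Unset Printing Implicit Defensive.

Import Order.TTheory GRing.Theory Num.Theory.
Local Open Scope ring_scope.

Definition compatible_roots_of_unity (zeta : nat -> algC) : Prop :=
  (forall k, (0 < k)%N -> k.-primitive_root (zeta k)) /\
  (forall k l, (0 < l)%N -> (k %| l)%N -> zeta l ^+ (l %/ k) = zeta k).

(* Number fields are subfields of an ambient finite normal extension F of the
   rationals, which is viewed inside the complex numbers through an embedding
   iota : F -> algC. *)

Definition generated_by (F : splittingFieldType rat)
    (iota : {rmorphism F -> algC}) (z : algC) (E : {subfield F}) : Prop :=
  exists2 w : F, iota w = z & E = <<1; w>>%AS.

(* The elements of the ring Z[z]. *)
Definition int_adjoin (z x : algC) : Prop :=
  exists q : {poly int}, x = (map_poly intr q).[z].

Definition max_real_subfield (F : splittingFieldType rat)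
    (iota : {rmorphism F -> algC}) (M K : {subfield F}) : Prop :=
  forall x : F, (x \in K) = (x \in M) && (iota x \is Num.real).

Section AssociatedOrder.

Variables (F : splittingFieldType rat) (E K : {subfield F}).

Definition ring_of_integers (x : F) : Prop :=
  x \in E /\ integralOver (intr : int -> F) x.

(* K[G] for G = Gal(E/K): the function a stands for the formal sum of the
   (a g) g.  Only its additive structure and its action on E are used, so no
   product is defined on it. *)
Definition group_algebra : Type :=
  {ffun [subg 'Gal(E / K)] -> subvs_of K}.

Definition group_algebra_act (a : group_algebra) (x : F) : F :=
  \sum_(g : [subg 'Gal(E / K)]) vsval (a g) * sgval g x.

Definition associated_order (a : group_algebra) : Prop :=
  forall x : F, ring_of_integers x -> ring_of_integers (group_algebra_act a x).

Definition integers_free_over_associated_order : Prop :=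
  exists (n : nat) (b : 'I_n -> F),
    (forall i, ring_of_integers (b i)) /\
    forall x : F, ring_of_integers x ->
      exists! a : {ffun 'I_n -> group_algebra},
        (forall i, associated_order (a i)) /\
        x = \sum_(i < n) group_algebra_act (a i) (b i).

Definition leopoldt : Prop :=
  [/\ (K <= E)%VS, galois 1 E, abelian 'Gal(E / 1)
    & integers_free_over_associated_order].

End AssociatedOrder.

(* The digits are c_0, ..., c_(m-1) with m = min(r, k); undup turns the
   enumeration of digit vectors into a duplicate-free list of values. *)
Definition digit_set (p r k : nat) : seq nat :=
  undup [seq (\sum_(i < minn r k) c i * p ^ i)%N
        | c : {ffun 'I_(minn r k) -> 'I_p}
          in [pred c : {ffun 'I_(minn r k) -> 'I_p} |
               [forall i : 'I_(minn r k),
                 (i == 0%N :> nat) ==> (1 <= c i <= p.-1./2)%N]]].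

Definition alpha (zeta : nat -> algC) (p r s : nat) : algC :=
  zeta (p ^ r)%N +
  \sum_(1 <= k < s.+1) \sum_(t <- digit_set p r k) zeta (p ^ (r + k))%N ^+ t.

(* Main.v *)
Require Import Defs.
From HB Require Import structures.
From mathcomp Require Import all_boot all_order all_fingroup all_algebra.
From mathcomp Require Import all_solvable all_field.
From mathcomp Require Import ring zify.

Import Order.TTheory GRing.Theory Num.Theory.
Local Open Scope ring_scope.

(** Write q = p^r, P = p^s, and let w be the chosen primitive root of unity of
    order p^(r + s), so that L = Q(w) and M = Q(w^P).  The Galois automorphisms of
    L over K are the maps w |-> w^j with j = +-1 mod q.  By discrete Fourier
    inversion on Z/P, for each function B : Z/P -> L such that g_j (B i) = B (i j)
    for all these j, some u in K[Gal(L/K)] satisfies u (w^i) = B i * w^i for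
    all i, and u lies in the associated order as soon as B has values in
    O_L = Z[w].  The sum alpha_s contains exactly one power w^i for each orbit of
    nonzero residues i mod P under multiplication by the exponents +-1 mod q, plus
    the term w^P for the zero orbit.  Taking B supported on one orbit isolates one
    term of alpha_s, and every power of w is then reached: for a nonzero orbit by
    twisting B by a root of unity or applying an automorphism, and for the zero
    orbit by multiplying w^P and its conjugate with the elements y + 1/y of O_K,
    for y a q-th root of unity. *)

(** * Integers of a cyclotomic field of prime power order *)

Section IntAdjoin.

Variable z : algC.

Lemma int_adjoin_int (n : int) : int_adjoin z n%:~R.
Proof. by exists n%:P; rewrite map_polyC hornerC. Qed.

Lemma int_adjoin_gen : int_adjoin z z.
Proof. by exists 'X; rewrite map_polyX hornerX. Qed.

Lemma int_adjoinD x y : int_adjoin z x -> int_adjoin z y -> int_adjoin z (x + y).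
Proof. by case=> a -> [b ->]; exists (a + b); rewrite rmorphD hornerD. Qed.

Lemma int_adjoinM x y : int_adjoin z x -> int_adjoin z y -> int_adjoin z (x * y).
Proof. by case=> a -> [b ->]; exists (a * b); rewrite rmorphM hornerM. Qed.

Lemma int_adjoinN x : int_adjoin z x -> int_adjoin z (- x).
Proof. by case=> a ->; exists (- a); rewrite rmorphN hornerN. Qed.

Lemma int_adjoinX x n : int_adjoin z x -> int_adjoin z (x ^+ n).
Proof. by case=> a ->; exists (a ^+ n); rewrite rmorphXn horner_exp. Qed.

Lemma int_adjoin_sum (I : Type) (r : seq I) (P : pred I) (f : I -> algC) :
  (forall i, P i -> int_adjoin z (f i)) -> int_adjoin z (\sum_(i <- r | P i) f i).
Proof.
move=> fP; elim/big_ind: _ => //; last exact: int_adjoinD.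
exact: (int_adjoin_int 0).
Qed.

Lemma int_adjoin_Aint x : z \in Aint -> int_adjoin z x -> x \in Aint.
Proof.
move=> zA [q ->]; rewrite horner_coef rpred_sum // => i _.
by rewrite coef_map rpredM ?rpredX ?Aint_int.
Qed.

End IntAdjoin.

Lemma exprD_prime_mod (R : comNzRingType) (p : nat) (a b : R) : prime p ->
  exists v, (a + b) ^+ p = a ^+ p + b ^+ p + p%:R * v.
Proof.
case: p => // p p_pr.
exists (\sum_(i < p) (a ^+ (p - i) * b ^+ i.+1) *+ ('C(p.+1, i.+1) %/ p.+1)).
rewrite exprDn big_ord_recl big_ord_recr /= subn0 bin0 subnn binn !expr0.
rewrite mulr1 mul1r !mulr1n -[RHS]addrA; congr (_ + _); rewrite addrC; congr (_ + _).
rewrite mulr_sumr; apply: eq_bigr => i _; rewrite mulr_natl -mulrnA divnK //.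
by rewrite prime_dvd_bin //= ltnS ltn_ord.
Qed.

(** Frobenius modulo [p], iterated [m] times; [p] odd keeps the sign of the constant term. *)
Lemma Xsub1_expX_mod (p m : nat) : prime p -> odd p ->
  exists v : {poly int}, ('X - 1) ^+ (p ^ m)%N = 'X^(p ^ m) - 1 + p%:R * v.
Proof.
move=> p_pr p_odd; elim: m => [|m [v IHm]].
  by exists 0; rewrite expn0 !expr1 mulr0 addr0.
rewrite expnSr exprM IHm.
have [v1 ->] := exprD_prime_mod _ p ('X^(p ^ m) - 1) (p%:R * v) p_pr.
have [v2 ->] := exprD_prime_mod _ p ('X^(p ^ m)) (-1 : {poly int}) p_pr.
rewrite -signr_odd p_odd expr1 -exprM exprMn -(prednK (prime_gt0 p_pr)) exprS.
by exists (v2 + v1 + p%:R ^+ p.-1 * v ^+ p.-1.+1); rewrite prednK ?prime_gt0 //; ring.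
Qed.

Lemma sum_unity_root (R : idomainType) (n : nat) (x : R) : x ^+ n = 1 ->
  \sum_(i < n) x ^+ i = if x == 1 then n%:R else 0.
Proof.
move=> xn1; case: eqP => [-> | /eqP x_neq1].
  by under eq_bigr do rewrite expr1n; rewrite sumr_const card_ord.
apply/eqP; rewrite -subr_eq0 in x_neq1.
by rewrite -(mulrI_eq0 _ (mulfI x_neq1)) -subrX1 xn1 subrr.
Qed.

Section PrimePowerCyclotomic.

Variables (p m : nat) (z : algC).
Hypotheses (p_pr : prime p) (p_odd : odd p) (m_gt0 : (0 < m)%N).
Hypothesis prim_z : (p ^ m).-primitive_root z.

Let zA : z \in Aint := Aint_prim_root prim_z.

Lemma prime_dvd_sub1_expX : 
  exists2 y, int_adjoin z y & (z - 1) ^+ (p ^ m)%N = p%:R * y.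
Proof.
have [v /(congr1 (fun q : {poly int} => (map_poly intr q).[z] : algC))] :=
  Xsub1_expX_mod p m p_pr p_odd.
rewrite rmorphXn !rmorphD rmorphM !rmorphN !rmorph1 rmorph_nat /= map_polyX map_polyXn.
rewrite horner_exp !hornerE (prim_expr_order prim_z) subrr add0r.
rewrite -polyC_natr hornerC => ->.
by exists (map_poly intr v).[z] => //; exists v.
Qed.

(** The powers of the primitive [p]-th root [z ^+ k] sum to 0, so [p] is the sum of the differences
    [1 - z ^+ (k * i)], each divisible by [z - 1]. *)
Lemma sub1_dvd_prime : exists2 y, int_adjoin z y & p%:R = (z - 1) * y.
Proof.
have [k Ek] : exists k, (p ^ m = k * p)%N.
  by exists (p ^ m.-1)%N; rewrite -expnSr prednK.
have prim_zk : p.-primitive_root (z ^+ k).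
  have := dvdn_prim_root prim_z (_ : (p %| p ^ m)%N).
  by rewrite dvdn_exp // => /(_ isT); rewrite Ek mulnK ?prime_gt0.
have s0 : \sum_(i < p) (z ^+ k) ^+ i = 0.
  rewrite sum_unity_root ?(prim_expr_order prim_zk) // -[z ^+ k]expr1.
  by rewrite -(prim_order_dvd prim_zk) dvdn1; case: eqP p_pr => // ->.
exists (- \sum_(i < p) \sum_(j < k * i) z ^+ j).
  by apply/int_adjoinN/int_adjoin_sum=> i _; apply: int_adjoin_sum => j _;
     apply: int_adjoinX; apply: int_adjoin_gen.
rewrite mulrN mulr_sumr.
under eq_bigr do rewrite -subrX1 exprM.
by rewrite sumrB s0 sumr_const card_ord sub0r opprK.
Qed.

(** Raised to the power [p ^ m], the equation makes [b ^+ (p ^ m) / p] a rational algebraic integer,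
    hence an integer. *)
Lemma prime_dvd_int_sub1 (b : int) (x : algC) :
  x \in Aint -> b%:~R = (z - 1) * x -> (p %| b)%Z.
Proof.
move=> xA Eb; have [y yZ Ey] := prime_dvd_sub1_expX.
have pNz : p%:R != 0 :> algC by rewrite pnatr_eq0 -lt0n prime_gt0.
have : (b ^+ (p ^ m)%N)%:~R / p%:R \is a @Num.int algC.
  apply: Cint_rat_Aint; first by rewrite rpred_div ?rpred_nat ?rpred_int.
  rewrite rmorphXn /= Eb exprMn Ey -[X in X / _]mulrA mulrAC divff // mul1r.
  by rewrite rpredM ?rpredX // (int_adjoin_Aint _ _ zA).
case/intrP=> c /(canRL (divfK pNz)) /eqP.
rewrite -[p%:R]/(p%:Z%:~R) -intrM eqr_int => /eqP Ec.
have : (p %| b ^+ (p ^ m)%N)%Z by rewrite Ec dvdz_mull.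
by rewrite !dvdzE abszX Euclid_dvdX // => /andP[].
Qed.

(** Modulo [z - 1], the value [q(z)] is the integer [q(1)], which is thus divisible by [p], itself a
    multiple of [z - 1] in Z[z]; then [z - 1] cancels. *)
Lemma int_adjoin_sub1_inv (x : algC) :
  x \in Aint -> int_adjoin z ((z - 1) * x) -> int_adjoin z x.
Proof.
move=> xA [q Eq].
have : root (q - q.[1]%:P) 1 by rewrite rootE !hornerE subrr.
case/factor_theorem=> q' /eqP; rewrite subr_eq => /eqP Eq'.
have Eqz : (map_poly intr q).[z] = (z - 1) * (map_poly intr q').[z] + q.[1]%:~R.
  rewrite [in LHS]Eq' rmorphD rmorphM rmorphB /= map_polyX !map_polyC !hornerE /=.
  by rewrite mulrC.
have q'Z : int_adjoin z (map_poly intr q').[z] by exists q'.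
set t := (map_poly intr q').[z] in Eqz q'Z.
have Eb : q.[1]%:~R = (z - 1) * (x - t) by rewrite mulrBr Eq Eqz; ring.
have /dvdzP[c Ec] : (p %| q.[1])%Z.
  by apply: prime_dvd_int_sub1 Eb; rewrite rpredB // (int_adjoin_Aint _ _ zA).
have [y yZ Ey] := sub1_dvd_prime.
have z_neq1 : z - 1 != 0.
  rewrite subr_eq0 -[z]expr1 -(prim_order_dvd prim_z) dvdn1.
  by rewrite gtn_eqF // -{1}(exp1n m) ltn_exp2r ?prime_gt1.
move: Eb; rewrite Ec intrM -[p%:Z%:~R]/(p%:R) Ey mulrCA => /(mulfI z_neq1) Ex.
rewrite -[x](subrK t) -Ex; apply: int_adjoinD q'Z.
exact/int_adjoinM/yZ/int_adjoin_int.
Qed.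

(** Since [p] divides [(z - 1) ^+ (p ^ m)], the factor [p ^ m] can be traded for a power of [z - 1],
    which is cancelled one factor at a time. *)
Lemma int_adjoin_order_inv (x : algC) :
  x \in Aint -> int_adjoin z ((p ^ m)%:R * x) -> int_adjoin z x.
Proof.
have [y yZ Ey] := prime_dvd_sub1_expX.
have yA := int_adjoin_Aint _ _ zA yZ.
move=> xA xZ.
have : int_adjoin z ((z - 1) ^+ (p ^ m * m)%N * x).
  by rewrite exprM Ey exprMn -natrX mulrAC; apply: int_adjoinM; last apply: int_adjoinX.
elim: (p ^ m * m)%N => [|k IHk]; first by rewrite mul1r.
rewrite exprS -mulrA => /int_adjoin_sub1_inv h; apply/IHk/h.
by rewrite rpredM ?rpredX ?rpredB ?rpred1.
Qed.

End PrimePowerCyclotomic.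

(** * Galois action and integrality in cyclotomic fields *)

Lemma rmorph_horner_rat (F : fieldExtType rat) (R : unitRingType)
    (f : {rmorphism F -> R}) (q : {poly rat}) (x : F) :
  f (map_poly (in_alg F) q).[x] = (map_poly ratr q).[f x].
Proof.
rewrite -horner_map -map_poly_comp; congr _.[_].
by apply: eq_map_poly => c /=; rewrite alg_num_field fmorph_rat.
Qed.

Section CyclotomicField.

Variables (F : splittingFieldType rat) (iota : {rmorphism F -> algC}).
Variables (n : nat) (w : F) (L : {subfield F}).
Hypothesis prim_w : n.-primitive_root w.
Hypothesis L_def : L = <<1; w>>%AS.

Lemma gen_in_cyclotomic : w \in L.
Proof. by rewrite L_def memv_adjoin. Qed.

Lemma prim_gen_neq0 : w != 0.
Proof. by rewrite (prim_root_eq0 prim_w) -lt0n (prim_order_gt0 prim_w). Qed.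

Lemma galois_cyclotomic : galois 1 L.
Proof.
apply/splitting_galoisField; exists ('X^n - 1); split.
- by rewrite rpredB ?rpred1 // polyOverXn.
- apply: separable_Xn_sub_1; rewrite -(fmorph_eq0 iota) rmorph_nat pnatr_eq0.
  by rewrite -lt0n (prim_order_gt0 prim_w).
exists [seq w ^+ i | i <- index_iota 0 n].
  by rewrite big_map (factor_Xn_sub_1 prim_w) eqpxx.
rewrite L_def; apply/eqP; rewrite eqEsubv; apply/andP; split.
  apply/Fadjoin_seqP; split; first exact: sub1v.
  by move=> _ /mapP[i _ ->]; rewrite rpredX // memv_adjoin.
apply/FadjoinP; split; first exact: subv_adjoin_seq.
(* For [n = 1] the list of roots contains only 1, and [w = 1]. *)
case: n prim_w => [|[|k]] pw; first by have := prim_order_gt0 pw.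
  by rewrite -[X in X \in _]expr1 (prim_expr_order pw) mem1v.
by apply: seqv_sub_adjoin; apply/mapP; exists 1%N; rewrite ?mem_index_iota ?expr1.
Qed.

Lemma gal_gen_pow (g : gal_of L) : exists j, g w = w ^+ j.
Proof.
have : (g w) ^+ n = 1 by rewrite -rmorphXn (prim_expr_order prim_w) rmorph1.
by case/(prim_rootP prim_w) => j ->; exists j.
Qed.

Lemma cyclotomic_poly x : x \in L -> exists q, x = (map_poly (in_alg F) q).[w].
Proof. by rewrite L_def => /Fadjoin1_polyP. Qed.

Lemma gal_eq_gen (g h : gal_of L) : g w = h w -> g = h.
Proof.
move=> gh; apply/eqP/gal_eqP => x /cyclotomic_poly[q ->].
by rewrite !rmorph_horner_rat /= gh.
Qed.

Lemma galMC (g h : gal_of L) : (g * h = h * g)%g.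
Proof.
apply: gal_eq_gen; rewrite !galM ?gen_in_cyclotomic //.
have [i Ei] := gal_gen_pow g; have [j Ej] := gal_gen_pow h.
by rewrite Ei Ej !rmorphXn /= Ei Ej -!exprM mulnC.
Qed.

Lemma abelian_cyclotomic : abelian 'Gal(L / 1).
Proof. by apply/centsP => g _ h _; apply: galMC. Qed.

(** A field morphism of [algC] raises [iota w] to the power [j], so [w ^+ j] is a root of the
    minimal polynomial of [w]; normality of [L] then gives [g]. *)
Lemma gal_gen_exists j : coprime j n -> exists g : gal_of L, g w = w ^+ j.
Proof.
move=> co_j_n; have [u Du] := Qn_aut_exists co_j_n.
have [_ _ nL] := and3P galois_cyclotomic.
have [|g _ <-] := normalField_root_minPoly (sub1v L) nL gen_in_cyclotomic (b := w ^+ j);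
  last by exists g.
have /polyOver1P[q Eq] := minPolyOver 1 w.
have /eqP := root_minPoly 1 w; rewrite rootE Eq.
move=> /(congr1 (u \o iota)) /=; rewrite !rmorph0 => Hu.
rewrite -(fmorph_eq0 iota) rmorph_horner_rat rmorphXn -Du.
  by apply/eqP; rewrite -[RHS]Hu; apply/esym/(rmorph_horner_rat _ _ (u \o iota)).
by rewrite -rmorphXn (prim_expr_order prim_w) rmorph1.
Qed.

Lemma int_adjoin_sub X : int_adjoin (iota w) X -> exists2 x, x \in L & iota x = X.
Proof.
case=> q ->; exists (map_poly intr q).[w].
  rewrite horner_coef rpred_sum // => i _; rewrite rpredM ?rpredX ?gen_in_cyclotomic //.
  by rewrite coef_map rpred_int.
rewrite -horner_map -map_poly_comp; congr _.[_].
by apply: eq_map_poly => c /=; rewrite rmorph_int.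
Qed.

Lemma integral_Aint x : integralOver (intr : int -> F) x -> iota x \in Aint.
Proof.
case=> q q_mon qx0; apply: (root_monic_Aint (p := map_poly intr q)).
- have := rmorph_root iota qx0; rewrite -map_poly_comp.
  by rewrite (eq_map_poly (_ : _ =1 intr)) // => c /=; rewrite rmorph_int.
- exact: monic_map.
by apply/polyOverP => i; rewrite coef_map /= intr_int.
Qed.

Lemma int_adjoin_integers x : int_adjoin (iota w) (iota x) -> ring_of_integers L x.
Proof.
case=> q Eq.
have Ex : x = (map_poly intr q).[w].
  apply: (fmorph_inj iota); rewrite Eq -horner_map -map_poly_comp; congr _.[_].
  by apply: eq_map_poly => c /=; rewrite rmorph_int.
split.
  have [y yL /fmorph_inj <-//] : exists2 y, y \in L & iota y = iota x.
  by apply: int_adjoin_sub; exists q.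
rewrite Ex; apply: integral_horner.
  apply/integral_poly => i; rewrite coef_map; exact: integral_id.
exists ('X^n - 1); first by rewrite monicXnsubC ?(prim_order_gt0 prim_w).
by rewrite rmorphB rmorph1 /= map_polyXn rootE !hornerE (prim_expr_order prim_w) subrr.
Qed.

(* Only g = 1 survives when the traces of [x * w ^- l] are summed back. *)
Lemma order_mul_traces x : x \in L ->
  n%:R * x = \sum_(l < n) galTrace 1 L (x * w ^- l) * w ^+ l.
Proof.
move=> xL; have w0 := prim_gen_neq0.
have gterm (g : gal_of L) l : g (x * w ^- l) * w ^+ l = g x * (w / g w) ^+ l.
  rewrite rmorphM rmorphV ?unitfE ?expf_neq0 //= rmorphXn expr_div_n.
  by rewrite -mulrA [_^-1 * _]mulrC.
rewrite /galTrace; under eq_bigr do rewrite mulr_suml.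
rewrite exchange_big /= (bigD1 1%g) ?group1 //= [X in _ + X]big1 ?addr0; last first.
  move=> g /andP[_ g_neq1].
  under eq_bigr do rewrite gterm.
  have gw0 : g w != 0 by rewrite fmorph_eq0.
  rewrite -mulr_sumr sum_unity_root.
    case: eqP => [/(canRL (divfK gw0)) | _]; last by rewrite mulr0.
    rewrite mul1r => Egw; case/eqP: g_neq1; apply: gal_eq_gen.
    by rewrite gal_id -Egw.
  by rewrite expr_div_n -rmorphXn (prim_expr_order prim_w) rmorph1 divr1.
under eq_bigr do rewrite gterm !gal_id divff // expr1n mulr1.
by rewrite sumr_const card_ord mulr_natl.
Qed.

(** The traces in the preceding formula are rational algebraic integers, hence integers. *)
Lemma int_adjoin_order_mul x : ring_of_integers L x ->
  int_adjoin (iota w) (n%:R * iota x).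
Proof.
case=> xL x_int; rewrite -(rmorph_nat iota) -rmorphM order_mul_traces // rmorph_sum.
apply: int_adjoin_sum => l _; rewrite rmorphM rmorphXn.
apply/int_adjoinM/int_adjoinX/int_adjoin_gen.
have yL : x * w ^- l \in L by rewrite rpredM ?rpredV ?rpredX ?gen_in_cyclotomic.
have /intrP[c ->] : iota (galTrace 1 L (x * w ^- l)) \is a Num.int;
  last exact: int_adjoin_int.
apply: Cint_rat_Aint.
  have /vlineP[c ->] := mem_galTrace galois_cyclotomic yL.
  by rewrite -[c *: 1]/(c%:A) alg_num_field fmorph_rat Crat_rat.
rewrite rmorph_sum rpred_sum // => g _; apply: integral_Aint.
have wV_int : integralOver (intr : int -> F) (w ^- l).
  exists ('X^n - 1); first by rewrite monicXnsubC ?(prim_order_gt0 prim_w).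
  rewrite rmorphB rmorph1 /= map_polyXn rootE !hornerE exprVn -exprM mulnC exprM.
  by rewrite (prim_expr_order prim_w) expr1n invr1 subrr.
have [q q_mon qy] := integral_mul x_int wV_int; exists q => //.
have := rmorph_root g qy; rewrite -map_poly_comp.
by rewrite (eq_map_poly (_ : _ =1 intr)) // => c /=; rewrite rmorph_int.
Qed.

End CyclotomicField.

Lemma integers_prime_power_cyclotomic (F : splittingFieldType rat)
    (iota : {rmorphism F -> algC}) (p m : nat) (w : F) (L : {subfield F}) (x : F) :
    prime p -> odd p -> (0 < m)%N -> (p ^ m).-primitive_root w ->
    L = <<1; w>>%AS ->
  ring_of_integers L x <-> int_adjoin (iota w) (iota x).
Proof.
move=> p_pr p_odd m_gt0 prim_w L_def.
split; last exact: int_adjoin_integers prim_w L_def _.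
move=> xO; have [_ x_int] := xO.
apply: (int_adjoin_order_inv p m) => //; first by rewrite fmorph_primitive_root.
  exact: integral_Aint.
exact: int_adjoin_order_mul prim_w L_def _ xO.
Qed.

(** * The action of a group algebra *)

Section GroupAlgebra.

Variables (F : splittingFieldType rat) (E K : {subfield F}).
Hypothesis sKE : (K <= E)%VS.
Implicit Types u v : group_algebra E K.

Fact group_algebra_act_is_linear u : linear (group_algebra_act u).
Proof.
move=> c x y; rewrite /group_algebra_act scaler_sumr -big_split /=.
by apply: eq_bigr => g _; rewrite linearP mulrDr scalerAr.
Qed.

HB.instance Definition _ u := GRing.isLinear.Build rat F F _ (group_algebra_act u)
  (group_algebra_act_is_linear u).

(** The family [g] may repeat values: coefficients of equal automorphisms are added. *)
Lemma group_algebra_of_sum (I : finType) (b : I -> F) (g : I -> gal_of E) :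
  (forall i, b i \in K) -> (forall i, g i \in 'Gal(E / K)%g) ->
  exists u, forall x, group_algebra_act u x = \sum_i b i * g i x.
Proof.
move=> bK gG.
exists [ffun h : [subg 'Gal(E / K)] => vsproj K (\sum_(i | subg _ (g i) == h) b i)] => x.
rewrite (partition_big (fun i => subg 'Gal(E / K) (g i)) predT) //=.
apply: eq_bigr => h _; rewrite ffunE vsprojK ?mulr_suml; last first.
  by apply: memv_suml => i _; exact: bK.
by apply: eq_bigr => i /eqP <-; rewrite subgK ?gG.
Qed.

(** This replaces the product of K[G]; it works because automorphisms over [K] fix the
    coefficients. *)
Lemma group_algebra_act_comp u v : exists t : group_algebra E K, forall x, x \in E ->
  group_algebra_act t x = group_algebra_act u (group_algebra_act v x).
Proof.
have [||t Dt] := group_algebra_of_sum ([subg 'Gal(E / K)] * [subg 'Gal(E / K)])%type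
  (* In a product of automorphisms the left factor acts first, hence the swap. *)
  (fun i => vsval (u i.1) * vsval (v i.2)) (fun i => sgval i.2 * sgval i.1)%g.
- by move=> i; rewrite rpredM ?subvsP.
- by move=> i; rewrite groupM ?subgP.
exists t => x xE; rewrite Dt /group_algebra_act -(pair_bigA _ (fun g h =>
  vsval (u g) * vsval (v h) * (sgval h * sgval g)%g x)) /=.
apply: eq_bigr => g _; rewrite rmorph_sum mulr_sumr; apply: eq_bigr => h _.
by rewrite rmorphM /= galM // (fixed_gal sKE (subgP g) (subvsP _)) mulrA.
Qed.

Lemma group_algebra_act_comm u v x :
    {in 'Gal(E / K)%g &, commutative (@mulg (gal_of E))} -> x \in E ->
  group_algebra_act u (group_algebra_act v x)
    = group_algebra_act v (group_algebra_act u x).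
Proof.
move=> GC xE; rewrite /group_algebra_act.
under eq_bigr do rewrite rmorph_sum mulr_sumr.
under [RHS]eq_bigr do rewrite rmorph_sum mulr_sumr.
rewrite exchange_big /=; apply: eq_bigr => g _; apply: eq_bigr => h _.
rewrite !rmorphM /= (fixed_gal sKE (subgP h) (subvsP _)).
rewrite (fixed_gal sKE (subgP g) (subvsP _)) -!galM // GC ?subgP //.
by rewrite mulrCA.
Qed.

(** Dedekind's independence of automorphisms. *)
Lemma group_algebra_act_eq0 u :
  (forall x, x \in E -> group_algebra_act u x = 0) -> u = 0.
Proof.
move=> u0; apply/ffunP => g; rewrite ffunE; apply: val_inj; rewrite /=.
pose c h := vsval (u (subg 'Gal(E / K) h)).
have -> : vsval (u g) = c (sgval g) by rewrite /c sgvalK.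
suff c0 h : h \in 'Gal(E / K)%g -> c h = 0 by rewrite c0 ?subgP.
move: h; apply: gal_independent => x xE.
rewrite -[RHS](u0 x xE) /group_algebra_act.
rewrite (reindex_onto (subg 'Gal(E / K)%g) (@sgval _ _)) /=.
  apply: eq_big => h => [|hG]; last by rewrite subgK.
  by apply/idP/eqP => [/subgK // | <-]; apply: subgP.
by move=> h _; rewrite sgvalK.
Qed.

End GroupAlgebra.

(** * Digits and orders of powers of a root of unity *)

Lemma sum_digits (p t m : nat) : (0 < p)%N ->
  (\sum_(i < m) (t %/ p ^ i %% p) * p ^ i = t %% p ^ m)%N.
Proof.
move=> p_gt0; elim: m => [|m IHm]; first by rewrite big_ord0 modn1.
rewrite big_ord_recr /= IHm modn_divl -expnS.
by rewrite [RHS](divn_eq _ (p ^ m)) modn_dvdm ?dvdn_exp2l // addnC.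
Qed.

Lemma digits_lt (p m : nat) (c : nat -> nat) : (forall i, c i < p)%N ->
  (\sum_(i < m) c i * p ^ i < p ^ m)%N.
Proof.
move=> c_lt; elim: m => [|m IHm]; first by rewrite big_ord0.
rewrite big_ord_recr /= expnS; apply: (@leq_trans ((c m).+1 * p ^ m)).
  by rewrite mulSn ltn_add2r.
by rewrite leq_mul2r c_lt orbT.
Qed.

(** The lowest digit is [t %% p] and the others are free, so membership is a bound and a residue
    condition. *)
Lemma mem_digit_set (p r k t : nat) : (1 < p)%N -> (0 < minn r k)%N ->
  (t \in digit_set p r k) = (t < p ^ minn r k)%N && (1 <= t %% p <= p.-1./2)%N.
Proof.
move=> p_gt1 m_gt0; have p_gt0 := ltnW p_gt1; rewrite mem_undup.
case: (minn r k) m_gt0 => // m _.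
apply/imageP/andP => [[c /forallP cP ->] | [t_lt tP]].
  have c0P := cP ord0; split.
    have := digits_lt p m.+1 (fun i => c (inord i)) (fun i => ltn_ord _).
    by under eq_bigr do rewrite inord_val.
  rewrite big_ord_recl /= muln1 -modnDmr (_ : (\sum_(i < m) _ = 0 %[mod p])%N).
    by rewrite mod0n addn0 modn_small.
  apply/eqP; rewrite mod0n; apply: dvdn_sum => i _.
  by rewrite /bump /= expnS mulnCA dvdn_mulr.
exists [ffun i : 'I_m.+1 => Ordinal (ltn_pmod (t %/ p ^ i) p_gt0)].
  apply/forallP => i; apply/implyP => /eqP i0.
  by rewrite ffunE /= i0 expn0 divn1.
under eq_bigr do rewrite ffunE /=.
by rewrite sum_digits // modn_small.
Qed.

Lemma dvdn_expM_coprime (p i a x : nat) : prime p -> ~~ (p %| x)%N ->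
  (p ^ i %| p ^ a * x)%N = (i <= a)%N.
Proof.
move=> p_pr px; have x_gt0 : (0 < x)%N by case: x px => //; rewrite dvdn0.
have pa_gt0 : (0 < p ^ a)%N by rewrite expn_gt0 prime_gt0.
rewrite (pfactor_dvdn _ p_pr) ?muln_gt0 ?pa_gt0 //.
by rewrite lognM // pfactorK // logn_coprime ?addn0 // prime_coprime.
Qed.

(* Both powers of h have the same order, and that order determines a. *)
Lemma prim_root_expr_val (R : unitRingType) (p a b m x y : nat) (h : R) :
    prime p -> (0 < m)%N -> ~~ (p %| x)%N -> ~~ (p %| y)%N ->
    (p ^ (b + m)).-primitive_root h ->
    h ^+ (p ^ a * x) = h ^+ (p ^ b * y) \/ h ^+ (p ^ a * x) = h ^- (p ^ b * y) ->
  a = b.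
Proof.
move=> p_pr m_gt0 px py prim_h Eh.
have Ee e : (p ^ (b + m) %| p ^ (a + e) * x)%N = (p ^ (b + m) %| p ^ (b + e) * y)%N.
  rewrite !(prim_order_dvd prim_h) ![(p ^ (_ + e))%N]expnD ![(_ * p ^ e * _)%N]mulnAC.
  rewrite (exprM h (p ^ a * x)) (exprM h (p ^ b * y)).
  by case: Eh => ->; rewrite ?exprVn ?invr_eq1.
(* Taking [e = m] gives [b <= a]; taking [e = m - 1] gives [a <= b]. *)
have := Ee m; rewrite !dvdn_expM_coprime // leqnn leq_add2r => ba.
have := Ee m.-1; rewrite !dvdn_expM_coprime //; lia.
Qed.

(** * The orbit of the generator under the associated order *)

Lemma modn_inv_exists (j n : nat) : (0 < n)%N -> coprime j n ->
  exists k, (j * k = 1 %[mod n])%N.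
Proof.
move=> n_gt0 co_jn; exists (j ^ (totient n).-1)%N.
by rewrite -expnS prednK ?totient_gt0 // Euler_exp_totient.
Qed.

(** The congruence of [j] to -1 is written [q %| j.+1] to stay within the natural numbers. *)
Definition congr_pm1 (q j : nat) := (j == 1 %[mod q]) || (q %| j.+1)%N.

Lemma congr_pm1_expr (R : unitRingType) (q j : nat) : congr_pm1 q j ->
  (forall x : R, x ^+ q = 1 -> x ^+ j = x) \/
  (forall x : R, x ^+ q = 1 -> x ^+ j = x^-1).
Proof.
case/orP=> [/eqP Ej | /dvdnP[k Ej]]; [left | right] => x xq1.
  by rewrite -(expr_mod j xq1) Ej (expr_mod 1 xq1) expr1.
have xj1 : x * x ^+ j = 1 by rewrite -exprS Ej mulnC exprM xq1 expr1n.
have xU : x \is a GRing.unit.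
  by apply/unitrP; exists (x ^+ j); rewrite -exprSr exprS.
by rewrite -[LHS](mulKr xU) xj1 mulr1.
Qed.

Lemma congr_pm1_coprime (p r j m : nat) : prime p -> (0 < r)%N ->
  congr_pm1 (p ^ r) j -> coprime j (p ^ m).
Proof.
move=> p_pr r_gt0; have pq : (p %| p ^ r)%N by rewrite dvdn_exp.
move=> jP; apply: coprimeXr; rewrite coprime_sym prime_coprime //.
apply/negP => pj; case/orP: jP => [/eqP Ej | /(dvdn_trans pq)].
  have : (p %| 1)%N; last by rewrite Euclid_dvd1.
  have := congr1 (fun i => i %% p)%N Ej; rewrite !modn_dvdm // => Ej'.
  by rewrite /dvdn -Ej'.
by rewrite -addn1 dvdn_addr // Euclid_dvd1.
Qed.

(** * Automorphisms over the real subfield and Fourier multipliers *)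

Section RelativeCyclotomic.

Variables (F : splittingFieldType rat) (iota : {rmorphism F -> algC}).
Variables (p r s : nat) (w : F) (L M K : {subfield F}).
Hypotheses (p_pr : prime p) (p_odd : odd p) (r_gt0 : (0 < r)%N).
Hypothesis prim_w : (p ^ (r + s)).-primitive_root w.
Hypothesis L_def : L = <<1; w>>%AS.
Hypothesis M_def : M = <<1; w ^+ (p ^ s)>>%AS.
Hypothesis K_def : max_real_subfield iota M K.

Local Notation N := (p ^ (r + s))%N.
Local Notation P := (p ^ s)%N.
Local Notation q := (p ^ r)%N.

Let wL : w \in L := gen_in_cyclotomic _ _ _ L_def.
Let w_neq0 : w != 0 := prim_gen_neq0 _ _ _ prim_w.

Lemma prim_wP : q.-primitive_root (w ^+ P).
Proof.
have := dvdn_prim_root prim_w (_ : (q %| N)%N).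
by rewrite expnD dvdn_mulr // mulKn ?expn_gt0 ?prime_gt0 //; apply.
Qed.

Lemma sub_M_L : (M <= L)%VS.
Proof.
by rewrite M_def; apply/FadjoinP; rewrite sub1v rpredX.
Qed.

Lemma sub_K_L : (K <= L)%VS.
Proof.
by apply/subvP => x; rewrite K_def => /andP[xM _]; apply: (subvP sub_M_L).
Qed.

(** The generator of [M] has absolute value 1, so its conjugate is its inverse, which is also its
    [j]-th power. *)
Lemma conj_gal_M (g : gal_of L) j x : (q %| j.+1)%N -> g w = w ^+ j -> x \in M ->
  iota (g x) = (iota x)^*.
Proof.
move=> qj gw /(cyclotomic_poly _ _ _ M_def)[f ->].
have zq1 : iota (w ^+ P) ^+ q = 1.
  by rewrite -rmorphXn (prim_expr_order prim_wP) rmorph1.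
have EC : (iota (w ^+ P))^* = (iota (w ^+ P)) ^+ j.
  have n1 : `|iota (w ^+ P)| = 1.
    apply/eqP; rewrite -(@pexpr_eq1 _ _ q) ?expn_gt0 ?prime_gt0 // -normrX zq1.
    by rewrite normr1.
  have z0 : iota (w ^+ P) != 0 by rewrite -normr_eq0 n1 oner_eq0.
  apply: (mulfI z0); rewrite -normCK n1 expr1n -exprS.
  by case/dvdnP: qj => k ->; rewrite mulnC exprM zq1 expr1n.
rewrite -[LHS]/((iota \o g) _) -[RHS]/((Num.conj \o iota) _) !rmorph_horner_rat /=.
by rewrite EC (rmorphXn g) /= gw exprAC [in LHS]rmorphXn.
Qed.

Lemma congr_pm1_gal (g : gal_of L) j : congr_pm1 q j -> g w = w ^+ j ->
  g \in 'Gal(L / K)%g.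
Proof.
move=> jP gw; rewrite gal_kHom ?sub_K_L //; apply/kAHomP => x xK.
have := xK; rewrite K_def => /andP[xM x_real].
case/orP: (jP) => [/eqP Ej | qj]; last first.
  by apply: (fmorph_inj iota); rewrite (conj_gal_M _ _ _ qj) // conj_Creal.
have [f ->] := cyclotomic_poly _ _ _ M_def _ xM.
rewrite rmorph_horner_rat rmorphXn /= gw exprAC.
rewrite -(expr_mod j (prim_expr_order prim_wP)) Ej.
rewrite (expr_mod _ (prim_expr_order prim_wP)) expr1; congr _.[_].
by apply: eq_map_poly => c; rewrite /= alg_num_field.
Qed.

Lemma congr_pm1_gal_exists j : congr_pm1 q j ->
  exists2 g : gal_of L, g \in 'Gal(L / K)%g & g w = w ^+ j.
Proof.
move=> jP; have [g gw] := gal_gen_exists _ iota _ _ _ prim_w L_def j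
  (congr_pm1_coprime _ _ _ _ p_pr r_gt0 jP).
by exists g => //; apply: congr_pm1_gal gw.
Qed.

Lemma congr_pm1_predN : congr_pm1 q N.-1.
Proof.
by rewrite /congr_pm1 prednK ?expn_gt0 ?prime_gt0 // expnD dvdn_mulr // orbT.
Qed.

(** Automorphisms over [M] have exponents congruent to 1, which puts [x] in [M]; the exponent [N.-1]
    acts as conjugation, which makes [x] real. *)
Lemma fixed_in_K x : x \in L ->
  (forall (g : gal_of L) j, congr_pm1 q j -> g w = w ^+ j -> g x = x) -> x \in K.
Proof.
move=> xL fix_x; have xM : x \in M.
  have sML : (1 <= M <= L)%VS by rewrite sub1v sub_M_L.
  have /galois_fixedField <- :=
    galoisS sML (galois_cyclotomic _ iota _ _ _ prim_w L_def).
  apply/fixedFieldP => // g gM; have [j gw] := gal_gen_pow _ _ _ _ prim_w g.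
  apply: fix_x (gw); apply/orP; left; rewrite -(eq_prim_root_expr prim_wP) expr1.
  rewrite exprAC -gw -rmorphXn /= (fixed_gal sub_M_L gM) //.
  by rewrite M_def memv_adjoin.
rewrite K_def xM CrealE; have [g _ gw] := congr_pm1_gal_exists _ congr_pm1_predN.
rewrite -(conj_gal_M g N.-1) // ?(fix_x _ _ congr_pm1_predN gw) ?eqxx //.
by rewrite prednK ?expn_gt0 ?prime_gt0 // expnD dvdn_mulr.
Qed.

(* The discrete Fourier transform on Z/P identifies the elements of K[Gal(L/M)]
   with the functions B : Z/P -> L that commute with the exponents +-1 mod q;
   u acts on the power w ^+ i as multiplication by B i. *)
Lemma multiplier_exists (B : nat -> F) :
    (forall i, B i \in L) -> (forall i, B (i %% P)%N = B i) ->
    (forall (g : gal_of L) j i, congr_pm1 q j -> g w = w ^+ j ->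
       g (B i) = B (i * j)%N) ->
  exists u : group_algebra L K, forall i,
    group_algebra_act u (w ^+ i) = w ^+ i * B i.
Proof.
move=> BL Bmod Bequiv; have P_gt0 : (0 < P)%N by rewrite expn_gt0 prime_gt0.
pose o := w ^+ q; have prim_o : P.-primitive_root o.
  have := dvdn_prim_root prim_w (_ : (P %| N)%N).
  by rewrite expnD dvdn_mull // mulnK //; apply.
have o_neq0 : o != 0 by rewrite expf_neq0.
(* Fourier coefficients of [B]; [b y] will multiply the automorphism with exponent [1 + q * y]. *)
pose b (y : 'I_P) := P%:R^-1 * \sum_(l < P) B l * o ^- (l * y).
have bK y : b y \in K.
  apply: fixed_in_K => [|g j jP gw].
    rewrite rpredM ?rpredV ?rpred_nat // rpred_sum // => l _.
    by rewrite rpredM ?rpredV ?rpredX.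
  rewrite rmorphM fmorphV rmorph_nat rmorph_sum; congr (_ * _).
  (* Multiplication by [j] permutes Z/P, and [g] permutes the summands of [b y] accordingly. *)
  pose f (l : 'I_P) := Ordinal (ltn_pmod (l * j) P_gt0).
  have f_inj : injective f.
    have [k Ek] := modn_inv_exists j P P_gt0 (congr_pm1_coprime _ _ _ _ p_pr r_gt0 jP).
    move=> l l' /(congr1 val) /= El; apply: val_inj => /=.
    rewrite -(modn_small (ltn_ord l)) -(modn_small (ltn_ord l')).
    have muljk i : (i = i * j * k %[mod P])%N.
      by rewrite -mulnA -modnMmr Ek modnMmr muln1.
    by rewrite muljk [in RHS]muljk -modnMml El modnMml.
  rewrite [RHS](reindex_inj f_inj) /=; apply: eq_bigr => l _.
  rewrite rmorphM /= (Bequiv _ _ _ jP gw) Bmod fmorphV !rmorphXn /= gw.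
  congr (_ * _^-1).
  rewrite exprM -[in RHS](expr_mod _ (prim_expr_order prim_o)).
  rewrite modnMml (expr_mod _ (prim_expr_order prim_o)) /o -!exprM.
  by congr (_ ^+ _); ring.
have gex (y : 'I_P) : exists2 g : gal_of L, g \in 'Gal(L / K)%g & g w = w ^+ (q * y).+1.
  by apply: congr_pm1_gal_exists; rewrite /congr_pm1 -addn1 mulnC modnMDl eqxx.
have [g gG gw] := fin_all_exists2 gex.
have [u Du] := group_algebra_of_sum _ _ _ _ b g bK gG.
exists u => i; rewrite Du.
under eq_bigr => y _.
  rewrite rmorphXn /= gw -exprM mulSn exprD mulrCA -mulnA exprM /b -mulrA mulr_suml.
  over.
rewrite -!mulr_sumr exchange_big /=; congr (_ * _).
rewrite -(Bmod i); pose k := Ordinal (ltn_pmod i P_gt0).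
(* Orthogonality of characters leaves only the index [l = i] modulo [P]. *)
have term (l : 'I_P) : \sum_(y < P) B l * o ^- (l * y) * o ^+ (y * i) =
    B l * (if l == k then P%:R else 0).
  transitivity (B l * \sum_(y < P) (o ^+ i / o ^+ l) ^+ y).
    rewrite mulr_sumr; apply: eq_bigr => y _; rewrite expr_div_n -!exprM.
    by rewrite [RHS]mulrA [LHS]mulrAC [(y * i)%N]mulnC.
  rewrite sum_unity_root; last first.
    rewrite expr_div_n (exprAC o i) (exprAC o l) (prim_expr_order prim_o).
    by rewrite !expr1n divr1.
  rewrite -(inj_eq (mulIf (expf_neq0 l o_neq0))) divfK ?expf_neq0 // mul1r.
  rewrite (eq_prim_root_expr prim_o) -val_eqE /= [(l %% _)%N]modn_small //.
  by rewrite [_ == val l]eq_sym.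
under eq_bigr do rewrite term.
rewrite (bigD1 k) //= eqxx big1 => [|l /negPf->]; last by rewrite mulr0.
rewrite addr0 mulrC mulfK // -(fmorph_eq0 iota) rmorph_nat pnatr_eq0 -lt0n //.
Qed.

Lemma integers_int_adjoin x : ring_of_integers L x <-> int_adjoin (iota w) (iota x).
Proof.
by apply: integers_prime_power_cyclotomic prim_w L_def; rewrite ?addn_gt0 ?r_gt0.
Qed.

Lemma integersD x y :
  ring_of_integers L x -> ring_of_integers L y -> ring_of_integers L (x + y).
Proof. by rewrite !integers_int_adjoin rmorphD; apply: int_adjoinD. Qed.

Lemma integersM x y :
  ring_of_integers L x -> ring_of_integers L y -> ring_of_integers L (x * y).
Proof. by rewrite !integers_int_adjoin rmorphM; apply: int_adjoinM. Qed.

Lemma integers_int (c : int) : ring_of_integers L c%:~R.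
Proof. by rewrite integers_int_adjoin rmorph_int; apply: int_adjoin_int. Qed.

Lemma integers_expr i : ring_of_integers L (w ^+ i).
Proof.
by rewrite integers_int_adjoin rmorphXn; apply/int_adjoinX/int_adjoin_gen.
Qed.

Lemma integers_sum (I : Type) (t : seq I) (Q : pred I) (f : I -> F) :
  (forall i, Q i -> ring_of_integers L (f i)) ->
  ring_of_integers L (\sum_(i <- t | Q i) f i).
Proof.
move=> fP; elim/big_ind: _ => //; last exact: integersD.
exact: (integers_int 0).
Qed.

Lemma integers_span x : ring_of_integers L x ->
  exists c : {poly int}, x = \sum_(i < size c) w ^+ i *~ c`_i.
Proof.
rewrite integers_int_adjoin => -[c Ec]; exists c; apply: (fmorph_inj iota).
rewrite Ec rmorph_sum /= horner_coef size_map_inj_poly //; last exact: intr_inj.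
by apply: eq_bigr => i _; rewrite rmorphMz rmorphXn /= -mulrzl coef_map.
Qed.

Lemma associated_order_expr (u : group_algebra L K) :
  (forall i, ring_of_integers L (group_algebra_act u (w ^+ i))) -> associated_order u.
Proof.
move=> uw x /integers_span[c ->]; rewrite raddf_sum; apply: integers_sum => i _.
by rewrite raddfMz -mulrzl; apply/integersM/uw/integers_int.
Qed.

(** The multiplier is supported on the orbit where [h ^+ i] is [h ^+ rho] or its inverse. The first
    hypothesis gives periodicity modulo [P], the next two equivariance, and the last makes the
    values [t] and [t^-1] agree when the two conditions coincide. *)
Lemma orbit_multiplier (e c rho : nat) (h := w ^+ c) (t := w ^+ e) :
    h ^+ P = 1 -> (h ^+ rho) ^+ q = 1 -> t ^+ q = 1 ->
    (h ^+ rho = h ^- rho -> t = 1) ->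
  exists2 u : group_algebra L K, associated_order u & forall i,
    group_algebra_act u (w ^+ i) = w ^+ i *
      (if h ^+ i == h ^+ rho then t else if h ^+ i == h ^- rho then t^-1 else 0).
Proof.
move=> hP hq tq ht; pose B i := if h ^+ i == h ^+ rho then t else
  if h ^+ i == h ^- rho then t^-1 else 0.
have tL : t \in L by apply: rpredX.
have [||g j i jP gw|u Du] := multiplier_exists B.
- by move=> i; rewrite /B; do 2?[case: ifP => _]; rewrite ?rpred0 ?rpredV.
- by move=> i; rewrite /B (expr_mod _ hP).
- have gh : g h = h ^+ j by rewrite /h rmorphXn /= gw exprAC.
  have gt : g t = t ^+ j by rewrite /t rmorphXn /= gw exprAC.
  have gi : h ^+ (i * j) = g (h ^+ i) by rewrite mulnC exprM -gh -rmorphXn.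
  have gr : g (h ^+ rho) = (h ^+ rho) ^+ j by rewrite exprAC -gh -rmorphXn.
  have gV : g (h ^- rho) = ((h ^+ rho) ^+ j)^-1 by rewrite fmorphV /= gr.
  (* Exponents congruent to 1 preserve both conditions; those congruent to -1 exchange them. *)
  rewrite /B gi; have [Ej|Ej] := congr_pm1_expr F _ _ jP.
    have -> : (g (h ^+ i) == h ^+ rho) = (h ^+ i == h ^+ rho).
      by rewrite -[RHS](inj_eq (fmorph_inj g)) /= gr Ej.
    have -> : (g (h ^+ i) == h ^- rho) = (h ^+ i == h ^- rho).
      by rewrite -[RHS](inj_eq (fmorph_inj g)) /= gV Ej.
    by do 2?[case: ifP => _]; rewrite ?fmorphV ?rmorph0 /= ?gt ?Ej.
  have -> : (g (h ^+ i) == h ^+ rho) = (h ^+ i == h ^- rho).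
    by rewrite -[RHS](inj_eq (fmorph_inj g)) /= gV Ej ?invrK.
  have -> : (g (h ^+ i) == h ^- rho) = (h ^+ i == h ^+ rho).
    by rewrite -[RHS](inj_eq (fmorph_inj g)) /= gr Ej.
  have [E1|_] := eqVneq (h ^+ i) (h ^+ rho); have [E2|_] := eqVneq (h ^+ i) (h ^- rho).
  - by rewrite (ht (etrans (esym E1) E2)) rmorph1.
  - by rewrite gt Ej.
  - by rewrite fmorphV /= gt Ej ?invrK.
  - by rewrite rmorph0.
exists u => //; apply: associated_order_expr => i; rewrite Du.
apply: integersM; first exact: integers_expr.
rewrite /B; case: ifP => _; first exact: integers_expr.
case: ifP => _; last exact: (integers_int 0).
have -> : t^-1 = t ^+ q.-1.
  apply: (mulfI (expf_neq0 e w_neq0)); rewrite divff ?expf_neq0 // -exprS prednK //.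
  by rewrite expn_gt0 prime_gt0.
by rewrite -exprM; apply: integers_expr.
Qed.

(** * The orbit of the lifted generator *)

Definition alpha_lift : F := w ^+ P +
  \sum_(1 <= k < s.+1) \sum_(t <- digit_set p r k) w ^+ (p ^ (s - k) * t).

Local Notation a := alpha_lift.

Lemma alpha_lift_integer : ring_of_integers L a.
Proof.
apply: integersD; first exact: integers_expr.
apply: integers_sum => k _; apply: integers_sum => t _; exact: integers_expr.
Qed.

Let aL : a \in L. Proof. by case: alpha_lift_integer. Qed.

(** The module generated by [alpha_lift] over the associated order, to be identified with the ring
    of integers of [L]. *)
Definition order_orbit (x : F) : Prop :=
  exists2 u : group_algebra L K, associated_order u & x = group_algebra_act u a.

Lemma order_orbitD x y : order_orbit x -> order_orbit y -> order_orbit (x + y).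
Proof.
case=> u uA -> [v vA ->].
have E z : group_algebra_act (u + v) z = group_algebra_act u z + group_algebra_act v z.
  by rewrite /group_algebra_act -big_split; apply: eq_bigr => g _; rewrite ffunE mulrDl.
by exists (u + v) => // z zO; rewrite E; apply: integersD; auto.
Qed.

Lemma order_orbit_act (v : group_algebra L K) x :
  associated_order v -> order_orbit x -> order_orbit (group_algebra_act v x).
Proof.
move=> vA [u uA ->]; have [t Et] := group_algebra_act_comp _ _ _ sub_K_L v u.
exists t => [z zO|]; last by rewrite Et.
have [zL _] := zO; rewrite Et //; exact/vA/uA.
Qed.

Lemma order_orbit_scale_gal c (g : gal_of L) x : c \in K -> ring_of_integers L c ->
  g \in 'Gal(L / K)%g -> order_orbit x -> order_orbit (c * g x).
Proof.
move=> cK cO gG xT.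
have [//|//|u Eu] := group_algebra_of_sum _ L K unit (fun=> c) (fun=> g).
have {}Eu z : group_algebra_act u z = c * g z.
  by rewrite Eu big_const card_unit /= addr0.
rewrite -Eu; apply: order_orbit_act => //; apply: associated_order_expr => i.
rewrite Eu; apply: integersM => //; have [j gw] := gal_gen_pow _ _ _ _ prim_w g.
by rewrite rmorphXn /= gw -exprM; apply: integers_expr.
Qed.

Lemma order_orbit_gal (g : gal_of L) x :
  g \in 'Gal(L / K)%g -> order_orbit x -> order_orbit (g x).
Proof.
move=> gG xT; rewrite -[g x]mul1r; apply: order_orbit_scale_gal => //.
  exact: mem1v.
exact: (integers_int 1).
Qed.

Lemma order_orbit_scale c x : c \in K -> ring_of_integers L c ->
  order_orbit x -> order_orbit (c * x).
Proof.
move=> cK cO xT; by rewrite -[x](gal_id L); apply: order_orbit_scale_gal.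
Qed.

Lemma order_orbitMz x (c : int) : order_orbit x -> order_orbit (x *~ c).
Proof.
move=> xT; rewrite -mulrzl; apply: order_orbit_scale => //; first exact: rpred_int.
exact: integers_int.
Qed.

Let digit_setP k t : (0 < k)%N -> t \in digit_set p r k ->
  [/\ (t < p ^ minn r k)%N, (0 < t %% p)%N, (t %% p <= p.-1./2)%N & ~~ (p %| t)%N].
Proof.
move=> k_gt0; rewrite mem_digit_set ?prime_gt1 ?leq_min ?r_gt0 // => /and3P[? t0 ?].
by split => //; rewrite /dvdn -lt0n.
Qed.

(** An orbit multiplier isolates the term of index [k], [t0] and twists it by [w ^+ e]. Other levels
    differ in [p]-adic valuation; at the same level the bounds on the digits separate [t] from [t0]
    and from [- t0]. *)
Lemma order_orbit_component k t0 e : (0 < k <= s)%N -> t0 \in digit_set p r k ->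
  (w ^+ e) ^+ q = 1 -> order_orbit (w ^+ (p ^ (s - k) * t0) * w ^+ e).
Proof.
move=> /andP[k_gt0 k_le_s] t0S eq1; pose m := minn r k.
have m_gt0 : (0 < m)%N by rewrite leq_min r_gt0.
have [m_le_r m_le_k] : (m <= r)%N /\ (m <= k)%N by rewrite geq_minl geq_minr.
have [t0_lt t0p_gt0 t0p_le pt0] := digit_setP _ _ k_gt0 t0S.
(* With this [c], the element [h] has order [p ^ (s - k + m)], so [h ^+ (p ^ (s - k) * t)] detects
   exactly [t] modulo [p ^ m]. *)
pose c := (p ^ (r + k - m))%N; pose h := w ^+ c; pose rho := (p ^ (s - k) * t0)%N.
have prim_h : (p ^ (s - k + m)).-primitive_root h.
  have -> : (p ^ (s - k + m) = N %/ p ^ (r + k - m))%N.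
    rewrite -expnB ?prime_gt0 //; last by clear - k_le_s m_le_k; lia.
    by congr (_ ^ _)%N; clear - k_le_s m_le_k; lia.
  have := dvdn_prim_root prim_w (_ : (N %/ p ^ (r + k - m) %| N)%N).
  rewrite dvdn_div ?dvdn_exp2l //; last by clear - k_le_s m_le_r m_le_k; lia.
  rewrite -expnB ?prime_gt0 //; last by clear - k_le_s m_le_r m_le_k; lia.
  rewrite -expnB ?prime_gt0 //; last by clear - k_le_s m_le_r m_le_k; lia.
  rewrite (_ : (r + s - (r + s - (r + k - m)) = r + k - m)%N); first by apply.
  by clear - k_le_s m_le_k; lia.
have [|||E2|u uA Eu] := orbit_multiplier e c rho.
- apply/eqP; rewrite -(prim_order_dvd prim_h) dvdn_exp2l //.
  by clear - k_le_s m_le_k; lia.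
- apply/eqP; rewrite -exprM -(prim_order_dvd prim_h) mulnAC -expnD dvdn_mulr //.
  by rewrite dvdn_exp2l //; clear - k_le_s m_le_r m_le_k; lia.
- by [].
(* The element [h ^+ rho] is never its own inverse, as [p] does not divide [2 * t0]. *)
- have : (p ^ (s - k + m) %| p ^ (s - k) * (t0 + t0))%N.
    rewrite (prim_order_dvd prim_h) mulnDr exprD {1}E2 mulVf //.
    by rewrite !expf_neq0.
  rewrite addnn -muln2 dvdn_expM_coprime // ?Euclid_dvdM ?negb_or ?pt0 //=.
    by clear - m_gt0; lia.
  by rewrite dvdn_prime2 //; case: eqP p_odd => // ->.
have hP : (h ^+ P == h ^+ rho) = false /\ (h ^+ P == h ^- rho) = false.
  by split; apply/eqP => Eh; have := @prim_root_expr_val _ p s (s - k) m 1 t0 h;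
    rewrite muln1 Euclid_dvd1 // => /(_ p_pr m_gt0 isT pt0 prim_h);
    [move/(_ (or_introl Eh)) | move/(_ (or_intror Eh))];
    clear - k_gt0 k_le_s; lia.
have hk k' t : (0 < k' <= s)%N -> t \in digit_set p r k' -> k' != k ->
    (h ^+ (p ^ (s - k') * t) == h ^+ rho) = false /\
    (h ^+ (p ^ (s - k') * t) == h ^- rho) = false.
  move=> /andP[k'_gt0 k's] tS /eqP nk; have [_ _ _ pt] := digit_setP _ _ k'_gt0 tS.
  by split; apply/eqP => Eh;
    have := @prim_root_expr_val _ p (s - k') (s - k) m t t0 h p_pr m_gt0 pt pt0 prim_h;
    [move/(_ (or_introl Eh)) | move/(_ (or_intror Eh))];
    clear - k_le_s k's nk; lia.
have ht t : t \in digit_set p r k -> t != t0 ->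
    (h ^+ (p ^ (s - k) * t) == h ^+ rho) = false /\
    (h ^+ (p ^ (s - k) * t) == h ^- rho) = false.
  move=> tS /eqP nt; have [t_lt tp_gt0 tp_le pt] := digit_setP _ _ k_gt0 tS.
  split; apply/eqP.
    move/eqP; rewrite (eq_prim_root_expr prim_h) expnD -!muln_modr.
    rewrite eqn_pmul2l ?expn_gt0 ?prime_gt0 //.
    by rewrite !modn_small // => /eqP.
  (* This would make [t + t0] divisible by [p], but the lowest digits have a sum strictly between 0
     and [p]. *)
  move=> Eh; have : h ^+ (p ^ (s - k) * (t + t0)) = 1.
    by rewrite mulnDr exprD Eh mulVf ?expf_neq0.
  move/eqP; rewrite -(prim_order_dvd prim_h) expnD dvdn_pmul2l ?expn_gt0 ?prime_gt0 //.
  move/(dvdn_trans (dvdn_exp m_gt0 (dvdnn p))).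
  rewrite /dvdn -modnDm modn_small; clear - t0p_gt0 t0p_le tp_gt0 tp_le; lia.
exists u => //; rewrite /a raddfD raddf_sum /= Eu -/h !hP.1 !hP.2 mulr0 add0r.
rewrite (bigD1_seq k) ?iota_uniq ?mem_index_iota ?k_gt0 //= [X in _ + X]big1_seq ?addr0.
  rewrite raddf_sum (bigD1_seq t0) ?undup_uniq //= [X in _ + X]big1_seq ?addr0.
    by rewrite Eu eqxx.
  by move=> t /andP[nt tS]; rewrite /= Eu -/h (ht _ tS nt).1 (ht _ tS nt).2 mulr0.
move=> k' /andP[nk]; rewrite mem_index_iota ltnS => k'P.
rewrite raddf_sum big1_seq // => t /andP[_ tS].
by rewrite /= Eu -/h (hk _ _ k'P tS nk).1 (hk _ _ k'P tS nk).2 mulr0.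
Qed.

(** The multiplier of the zero orbit keeps only exponents divisible by [P]; all other terms of
    [alpha_lift] have valuation [s - k < s]. *)
Lemma order_orbit_wP : order_orbit (w ^+ P).
Proof.
have [|||_|u uA Eu] := orbit_multiplier 0 q 0; rewrite ?expr0 ?expr1n //.
  by rewrite -exprM -expnD (prim_expr_order prim_w).
have hE i : ((w ^+ q) ^+ i == 1) = (P %| i)%N.
  by rewrite -exprM -(prim_order_dvd prim_w) expnD dvdn_pmul2l ?expn_gt0 ?prime_gt0.
have {}Eu i : group_algebra_act u (w ^+ i) = w ^+ i *+ (P %| i)%N.
  by rewrite Eu !expr0 !invr1 hE; case: (P %| i)%N; rewrite ?mulr1 ?mulr0.
exists u => //; rewrite /a raddfD raddf_sum /= Eu dvdnn mulr1n.
rewrite big1_seq ?addr0 // => k /andP[_]; rewrite mem_index_iota => /andP[k_gt0 ks].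
rewrite raddf_sum big1_seq // => t /andP[_ /(digit_setP _ _ k_gt0)[_ _ _ pt]].
rewrite /= Eu dvdn_expM_coprime // (_ : (s <= s - k)%N = false) //.
by clear - k_gt0 ks; lia.
Qed.

(** The factor [y + y^-1] is an integer of [K]: exponents congruent to 1 or -1 fix or exchange its
    two terms. *)
Lemma order_orbit_mul_sym y x : y ^+ q = 1 -> order_orbit x ->
  order_orbit ((y + y^-1) * x).
Proof.
move=> yq1; have [i Ei] := prim_rootP prim_wP yq1.
have yV : y^-1 = y ^+ q.-1.
  have y0 : y != 0 by rewrite Ei !expf_neq0.
  apply: (mulfI y0); rewrite divff // -exprS prednK // ?expn_gt0 ?prime_gt0 //.
have yL : y \in L by rewrite Ei !rpredX.
have yE : exists j, y = w ^+ j by exists (P * i)%N; rewrite exprM.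
apply: order_orbit_scale.
  apply: fixed_in_K => [|g j jP gw]; first by rewrite rpredD ?rpredV.
  have gy : g y = y ^+ j.
    by case: yE => l ->; rewrite rmorphXn /= gw exprAC.
  rewrite rmorphD fmorphV /= gy.
  by have [->|->] := congr_pm1_expr F _ _ jP; rewrite ?invrK // addrC.
case: yE yV => l -> ->; apply: integersD; first exact: integers_expr.
by rewrite -exprM; apply: integers_expr.
Qed.

(* Multiplying w ^+ P and its inverse by suitable y + y^-1 in the real subfield
   shows that [order_orbit] is stable under the reflections x |-> (w ^+ P) ^+ 2 / x
   and x |-> (w ^+ P) ^- 2 / x, hence under multiplication by (w ^+ P) ^+ 4. *)
Lemma order_orbit_M i : order_orbit (w ^+ (P * i)).
Proof.
set z := w ^+ P; have z0 : z != 0 by rewrite expf_neq0.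
have zq1 : z ^+ q = 1 := prim_expr_order prim_wP.
have zT : order_orbit z := order_orbit_wP.
have zVT : order_orbit z^-1.
  have [g gG gw] := congr_pm1_gal_exists _ congr_pm1_predN.
  have <- : g z = z^-1; last exact: order_orbit_gal.
  apply: (mulfI z0); rewrite divff // /z rmorphXn /= gw exprAC -exprS prednK.
    by rewrite exprAC (prim_expr_order prim_w) expr1n.
  by rewrite expn_gt0 prime_gt0.
have zVq : z^-1 ^+ q = 1 by rewrite exprVn zq1 invr1.
have reflection z1 x : z1 ^+ q = 1 -> z1 != 0 -> order_orbit z1 -> x ^+ q = 1 ->
    order_orbit x -> order_orbit (z1 ^+ 2 / x).
  move=> z1q z10 z1T xq xT.
  have x0 : x != 0.
    apply/eqP => x0; move: xq; rewrite x0 expr0n expn_eq0 eqn0Ngt prime_gt0 //=.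
    by move/esym/eqP; rewrite oner_eq0.
  have -> : z1 ^+ 2 / x = (x / z1 + (x / z1)^-1) * z1 + x *~ (-1).
    by field; rewrite x0 z10.
  apply: order_orbitD; last exact: order_orbitMz.
  by apply: order_orbit_mul_sym => //; rewrite expr_div_n xq z1q divr1.
(* Two successive reflections multiply by [z ^+ 4], starting from [z]. *)
have four k : order_orbit (z ^+ (1 + 4 * k)).
  elim: k => [|k IHk]; first by rewrite muln0 expr1.
  have xq n : (z ^+ n) ^+ q = 1 by rewrite exprAC zq1 expr1n.
  have -> : z ^+ (1 + 4 * k.+1) = z ^+ 2 / (z^-1 ^+ 2 / z ^+ (1 + 4 * k)).
    rewrite mulnS addnCA exprD invf_div exprVn invrK [RHS]mulrCA.
    by rewrite -(exprD z 2 2) mulrC.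
  apply: (reflection z) => //.
    by rewrite expr_div_n xq divr1 exprAC zVq expr1n.
  by apply: (reflection z^-1); rewrite ?invr_eq0.
have co4 : coprime 4 q.
  by rewrite coprimeXr // -[4%N]/(2 ^ 2)%N coprimeXl // coprime2n.
have q_gt0 : (0 < q)%N by rewrite expn_gt0 prime_gt0.
have [k Ek] := modn_inv_exists 4 q q_gt0 co4.
(* With [k] inverse to 4 and [q.-1] standing for -1, the exponent is congruent to [i] modulo [q]. *)
have := four (k * (i + q.-1))%N; rewrite exprM.
suff -> : z ^+ (1 + 4 * (k * (i + q.-1))) = z ^+ i by [].
apply/eqP; rewrite (eq_prim_root_expr prim_wP) mulnA -modnDmr -modnMml Ek.
by rewrite modnMml mul1n modnDmr addnCA add1n prednK // modnDr.
Qed.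

(** Passing from the representative [t0] to [t] costs a twist by a [q]-th root of unity when
    [k <= r], and an automorphism over [K] when [r < k]. *)
Lemma order_orbit_half k t : (0 < k <= s)%N -> (0 < t %% p <= p.-1./2)%N ->
  order_orbit (w ^+ (p ^ (s - k) * t)).
Proof.
move=> kP tP; have /andP[k_gt0 k_le_s] := kP.
pose m := minn r k; have m_gt0 : (0 < m)%N by rewrite leq_min r_gt0.
pose t0 := (t %% p ^ m)%N.
have t0p : (t0 %% p = t %% p)%N by rewrite modn_dvdm // dvdn_exp.
have t0S : t0 \in digit_set p r k.
  by rewrite mem_digit_set ?prime_gt1 // t0p tP ltn_mod expn_gt0 prime_gt0.
have [k_le_r | r_lt_k] := leqP k r.
  have mk : m = k by apply/minn_idPr.
  have -> : (p ^ (s - k) * t = p ^ (s - k) * t0 + P * (t %/ p ^ k))%N.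
    rewrite [in LHS](divn_eq t (p ^ k)) mulnDr addnC /t0 mk; congr (_ + _)%N.
    by rewrite mulnCA mulnC -expnD subnK.
  rewrite exprD; apply: order_orbit_component => //.
  by rewrite exprM exprAC (prim_expr_order prim_wP) expr1n.
have mr : m = r by apply/minn_idPl/ltnW.
have pt : ~~ (p %| t)%N by rewrite /dvdn -lt0n; case/andP: tP.
have pt0 : ~~ (p %| t0)%N by rewrite /dvdn t0p -lt0n; case/andP: tP.
have pk_gt0 : (0 < p ^ (r + k))%N by rewrite expn_gt0 prime_gt0.
(* The quotient [t / t0], taken modulo the order of [w ^+ (p ^ (s - k))], is the exponent sought; it
   is 1 modulo [q] because [t0] is [t] modulo [q]. *)
have [|tau Etau] := modn_inv_exists t0 (p ^ (r + k)) pk_gt0.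
  by apply: coprimeXr; rewrite coprime_sym prime_coprime.
have jP : congr_pm1 q (t * tau)%N.
  rewrite /congr_pm1 -(modn_dvdm 1 (dvdnn q)); apply/orP; left.
  have dq : (q %| p ^ (r + k))%N by rewrite dvdn_exp2l // leq_addr.
  rewrite -modnMml -{1}mr -/t0 -(modn_dvdm (t0 * tau) dq) Etau !modn_dvdm //.
have [g gG gw] := congr_pm1_gal_exists _ jP.
have := order_orbit_component k t0 0 kP t0S; rewrite expr0 expr1n mulr1 => /(_ erefl).
move/(order_orbit_gal g _ gG); rewrite rmorphXn /= gw -exprM.
suff -> : w ^+ (t * tau * (p ^ (s - k) * t0)) = w ^+ (p ^ (s - k) * t) by [].
apply/eqP; rewrite (eq_prim_root_expr prim_w).
have -> : (r + s = s - k + (r + k))%N by clear - k_le_s; lia.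
rewrite expnD.
rewrite (_ : (t * tau * (_ * t0) = p ^ (s - k) * (t * (t0 * tau)))%N); last by ring.
by rewrite -!muln_modr -modnMmr Etau modnMmr muln1.
Qed.

Lemma order_orbit_expr i : order_orbit (w ^+ i).
Proof.
have [/dvdnP[l ->] | Pi] := boolP (P %| i)%N.
  by rewrite mulnC; apply: order_orbit_M.
have i_gt0 : (0 < i)%N by case: i Pi => //; rewrite dvdn0.
have [t co_pt Ei] := pfactor_coprime p_pr i_gt0.
rewrite prime_coprime // in co_pt.
have ls : (logn p i < s)%N by rewrite ltnNge -pfactor_dvdn.
pose k := (s - logn p i)%N; have kP : (0 < k <= s)%N by rewrite /k; clear - ls; lia.
have {}Ei : i = (p ^ (s - k) * t)%N.
  by rewrite {1}Ei mulnC; congr (_ ^ _ * _)%N; rewrite /k; clear - ls; lia.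
have tp_gt0 : (0 < t %% p)%N by rewrite lt0n.
have [t_le | t_gt] := leqP (t %% p) p.-1./2.
  by rewrite Ei; apply: order_orbit_half; rewrite // tp_gt0.
have N_gt0 : (0 < N)%N by rewrite expn_gt0 prime_gt0.
(* When [t %% p] is in the upper half, inversion of [w], with exponent [N.-1], moves it to the lower
   half. *)
have wNN : w ^+ (N.-1 * N.-1) = w.
  rewrite -[RHS]expr1; apply/eqP; rewrite (eq_prim_root_expr prim_w).
  have -> : (N.-1 * N.-1 = N.-2 * N + 1)%N.
    have : (1 < N)%N.
      by rewrite -{1}(exp1n (r + s)) ltn_exp2r ?prime_gt1 // addn_gt0 r_gt0.
    by case: N => [|[|n]] //= _; clear; nia.
  by rewrite modnMDl.
have [g gG gw] := congr_pm1_gal_exists _ congr_pm1_predN.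
have -> : w ^+ i = g (w ^+ (p ^ (s - k) * (t * N.-1))).
  by rewrite rmorphXn /= gw -exprM [(_ * (t * _))%N]mulnA -Ei mulnCA mulnC exprM wNN.
apply: order_orbit_gal => //; apply: order_orbit_half => //.
have pN : (p %| N)%N by rewrite dvdn_exp // addn_gt0 r_gt0.
(* The two nonzero residues add up to [p], so one of them is at most [p.-1./2]. *)
have pt : (t %% p + (t * N.-1) %% p = 0 %[mod p])%N.
  rewrite modnDm -mulnS prednK // mod0n; apply/eqP.
  by rewrite -/(p %| t * N)%N dvdn_mull.
have lt1 : (t %% p < p)%N by rewrite ltn_mod prime_gt0.
have lt2 : ((t * N.-1) %% p < p)%N by rewrite ltn_mod prime_gt0.
have : (p %| t %% p + (t * N.-1) %% p)%N by rewrite /dvdn pt mod0n.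
clear - p_odd t_gt tp_gt0 lt1 lt2; case/dvdnP => -[|[|l]].
- by rewrite mul0n; lia.
- by rewrite mul1n; lia.
- by rewrite !mulSn; lia.
Qed.

Lemma order_orbit_integers x : ring_of_integers L x -> order_orbit x.
Proof.
case/integers_span => c ->; elim/big_ind: _ => [||i _].
- by have := order_orbitMz _ 0 order_orbit_wP; rewrite mulr0z.
- exact: order_orbitD.
- exact/order_orbitMz/order_orbit_expr.
Qed.

(* K[Gal(L/K)] is commutative, so an element killing the generator kills L. *)
Lemma act_alpha_lift_inj (u : group_algebra L K) : group_algebra_act u a = 0 -> u = 0.
Proof.
move=> ua0; apply: group_algebra_act_eq0 => x /(cyclotomic_poly _ _ _ L_def)[f ->].
rewrite horner_coef raddf_sum big1 // => i _.
rewrite coef_map /= -scalerAl mul1r linearZ /=.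
have [v _ ->] := order_orbit_expr i.
rewrite (group_algebra_act_comm _ _ _ sub_K_L) //.
  by rewrite ua0 raddf0 scaler0.
by move=> g h _ _; apply: galMC prim_w L_def _ _.
Qed.

(** The ring of integers is free of rank one: the orbit gives existence of coefficients, and
    injectivity of the action on [alpha_lift] gives uniqueness. *)
Lemma leopoldt_relative_cyclotomic : leopoldt L K.
Proof.
split; first exact: sub_K_L.
- exact: galois_cyclotomic prim_w L_def.
- exact: abelian_cyclotomic prim_w L_def.
exists 1%N, (fun=> a); split=> [_ | x xO]; first exact: alpha_lift_integer.
have [u uA Eu] := order_orbit_integers _ xO.
exists [ffun=> u]; split.
  by split=> [i | ]; rewrite ?big_ord1 ffunE.
move=> v [_]; rewrite big_ord1 => Ev; apply/ffunP => i; rewrite ffunE (ord1 i).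
apply/eqP; rewrite -subr_eq0; apply/eqP/act_alpha_lift_inj.
rewrite -[RHS](subrr x) {1}Eu Ev /group_algebra_act -sumrB.
by apply: eq_bigr => g _; rewrite !ffunE mulrBl.
Qed.

End RelativeCyclotomic.

(** * Transfer to the chosen complex roots of unity *)

Theorem theorem9p2 (zeta : nat -> algC)
    (zetaP : compatible_roots_of_unity zeta)
    (p r s : nat) (p_prime : prime p) (p_odd : odd p) (r_ge1 : (1 <= r)%N)
    (r_p3 : p = 3%N -> (minn 2 s <= r)%N)
    (F : splittingFieldType rat) (iota : {rmorphism F -> algC})
    (L M K : {subfield F})
    (LE : generated_by iota (zeta (p ^ (r + s))%N) L)
    (ME : generated_by iota (zeta (p ^ r)%N) M)
    (KE : max_real_subfield iota M K) :
  (exists2 a : F, iota a = alpha zeta p r s &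
     forall x : algC, int_adjoin (zeta (p ^ (r + s))%N) x <->
       exists2 u : group_algebra L K,
         associated_order u & x = iota (group_algebra_act u a)) /\
  leopoldt L K.
Proof.
have [w iw L_def] := LE; have [w' iw' M_def] := ME.
have [zeta_prim zeta_compat] := zetaP.
have p_gt0 := prime_gt0 p_prime.
have prim_w : (p ^ (r + s)).-primitive_root w.
  by rewrite -(fmorph_primitive_root iota) iw zeta_prim // expn_gt0 p_gt0.
(* Compatibility expresses every root occurring in [alpha] as a power of the single generator
   [w]. *)
have zetaE k : (k <= s)%N -> zeta (p ^ (r + k))%N = iota (w ^+ (p ^ (s - k))).
  move=> ks; rewrite -(zeta_compat _ (p ^ (r + s))%N) ?expn_gt0 ?p_gt0 //.
    by rewrite -expnB ?leq_add2l // subnDl rmorphXn /= iw.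
  by rewrite dvdn_exp2l // leq_add2l.
have w'E : w' = w ^+ (p ^ s).
  by apply: (fmorph_inj iota); rewrite iw' -[r]addn0 zetaE // subn0.
rewrite w'E in M_def; pose a := alpha_lift F p r s w.
have integersE := integers_int_adjoin F iota p r s w L p_prime p_odd r_ge1 prim_w L_def.
split; last exact: leopoldt_relative_cyclotomic prim_w L_def M_def KE.
exists a => [|x].
  rewrite /a /alpha_lift /alpha rmorphD rmorph_sum -iw' w'E.
  congr (_ + _); apply: eq_big_nat => k /andP[_ ks]; rewrite rmorph_sum.
  by apply: eq_bigr => t _; rewrite zetaE // -rmorphXn -exprM.
rewrite -iw; split=> [xZ | [u uA ->]]; last first.
  by apply/integersE/uA; exact: alpha_lift_integer prim_w L_def.
have [y yL Ey] := int_adjoin_sub F iota w L L_def x xZ.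
have [|u uA Eu] := order_orbit_integers F iota p r s w L M K p_prime p_odd r_ge1 prim_w
  L_def M_def KE y.
  by apply/integersE; rewrite Ey.
by exists u => //; rewrite -Ey Eu.
Qed.
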